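(* Let $(W,\chi)$ be a contact manifold of dimension $2n+1$, let $G$ be an abelian group, and let $\mathcal{L}eg\subset J^1_n(W)$ be the first-order PDE encoding Legendrian submanifolds of $W$. Then the $G$-singular bordism group of compact submanifolds of $W$ bording by means of Legendrian submanifolds of $W$, i.e. the closed $G$-singular bordism group ${}^G\Omega^{\mathcal{L}eg}_{\bullet,s}$ (in degree $n-1$ for $(n-1)$-dimensional compact submanifolds bording by $n$-dimensional Legendrian submanifolds), is given by $${}^G\Omega^{\mathcal{L}eg}_{\bullet,s}\cong\bar H_\bullet(\mathcal{L}eg;G).$$ Moreover: - If ${}^G\Omega^{\mathcal{L}eg}_{\bullet,s}=0$, then $\overline{Bor}_\bullet(\mathcal{L}eg;G)\cong\overline{Cyc}_\bullet(\mathcal{L}eg;G)$. - If $\overline{Cyc}_\bullet(\mathcal{L}eg;G)$ is a free $G$-module, then $$\overline{Bor}_\bullet(\mathcal{L}eg;G)\cong{}^G\Omega^{\mathcal{L}eg}_{\bullet,s}\oplus\overline{Cyc}_\bullet(\mathcal{L}eg;G).$$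
   Context: **Contact structures.** A contact structure on a $(2n+1)$-dimensional manifold $W$ is a differential 1-form $\chi$ with $\chi(p)\wedge(d\chi(p))^n\neq0$ for all $p\in W$. A Legendrian submanifold is an $n$-dimensional submanifold $N\subset W$ with $\chi|_N=0$. **Jets and the PDE.** For an $n$-dimensional submanifold $N\subset W$ and $a\in N$, $[N]^1_a$ is the first-order jet of $N$ at $a$; $J^1_n(W)$ is the manifold of all such jets; $N^{(1)}=\{[N]^1_a:a\in N\}$. $\mathcal{L}eg=\{[N]^1_a\in J^1_n(W):\chi(a)|_{T_aN}=0\}$; in local coordinates $(x^\alpha,y_\alpha,z)_{1\le\alpha\le n}$ of $W$ with $\chi=dz-y_\alpha dx^\alpha$ and induced coordinates $(x^\alpha,y_\alpha,z,y_{\alpha\beta},z_\beta)$ of $J^1_n(W)$ it is given by $z_\beta-y_\beta=0$, $1\le\beta\le n$. The Cartan distribution $\mathbf{E}^1_n(W)\subset TJ^1_n(W)$ is generated by the tangent spaces of the prolongations $N^{(1)}$; for a submanifold $E\subset J^1_n(W)$, $\mathbf{E}=\mathbf{E}^1_n(W)\cap TE$. **Bar singular chains of a PDE $E$.** $\bar C_p(E;G)$ is the module of formal finite linear combinations $\sum\lambda_ic_i$, $\lambda_i\in G$, where each $c_i$ is a singular $p$-simplex $f:\Delta^p\to E$ that extends to a differentiable map on a neighbourhood $U\subset\mathbb{R}^{p+1}$ of $\Delta^p$ and satisfies $Tf(\Delta^p)\subset\mathbf{E}$. With the boundary $\bar\partial$ this is the bar singular chain complex; $\bar B_\bullet(E;G)=\mathrm{im}\,\bar\partial$,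 $\bar Z_\bullet(E;G)=\ker\bar\partial$, $\bar H_\bullet(E;G)=\bar Z_\bullet/\bar B_\bullet$. **Bordism groups.** $\overline{Bor}_\bullet(E;G)=\bar C_\bullet(E;G)/\bar B_\bullet(E;G)$; $\overline{Cyc}_\bullet(E;G)=\bar C_\bullet(E;G)/\bar Z_\bullet(E;G)$; the closed $G$-singular bordism group ${}^G\Omega^{E}_{\bullet,s}$ is the group of closed chains ($\bar\partial a=0$) modulo the relation $a-b=\bar\partial c$, and is the kernel of the canonical surjection $\overline{Bor}_\bullet(E;G)\to\overline{Cyc}_\bullet(E;G)$. *)

(* Defs.v *)
From HB Require Import structures.
From mathcomp Require Import all_boot all_order all_fingroup all_algebra.
From mathcomp Require Import finmap all_classical all_reals all_analysis.
From mathcomp Require Import generic_quotient ring_quotient.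
From mathcomp Require multinomials.monalg.
(* The notations of monalg clash with those of mathcomp-analysis. *)
Import -(notations) monalg.

Set Implicit Arguments.
Unset Strict Implicit.
Unset Printing Implicit Defensive.

Import Order.TTheory GRing.Theory Num.Theory.
Import numFieldNormedType.Exports.

Local Open Scope classical_set_scope.
Local Open Scope ring_scope.

Section Smooth.
Variables (R : realType) (V V' : normedModType R).

(* All iterated directional derivatives of order at most [k] exist and are
   continuous at the points of [U]; for [U] open in a finite-dimensional
   space this is the usual class C^k. *)
Fixpoint Ck (k : nat) (U : set V) (f : V -> V') : Prop :=
  (forall x, U x -> {for x, continuous f}) /\
  if k is k'.+1 then
    (forall x v, U x -> derivable f x v) /\ (forall v, Ck k' U ('D_v f))
  else True.

Definition smooth (U : set V) (f : V -> V') : Prop := forall k, Ck k U f.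

End Smooth.

Record charts (R : realType) (V : normedModType R) (M : Type) := Charts {
  chart_index : Type;
  chart_dom : chart_index -> set M;
  chart : chart_index -> M -> V
}.
Arguments chart_index {R V M}.
Arguments chart_dom {R V M}.
Arguments chart {R V M}.

Section Tangent.
Variables (R : realType) (V : normedModType R) (M : Type) (C : charts V M).

(* Smoothness on the open set [U], read in every chart around every value;
   the openness of [O] carries the continuity of [g]. *)
Definition smooth_map (V0 : normedModType R) (U : set V0) (g : V0 -> M) :=
  forall x i, U x -> chart_dom C i (g x) ->
    exists O : set V0,
      [/\ open O, O x, O `<=` U, O `<=` g @^-1` chart_dom C i
        & smooth O (chart C i \o g)].

(* A tangent vector is the class of a curve, where two curves are identified
   when they have the same derivative at 0 in every chart: it is recorded as
   the family of these derivatives (0 for the charts not containing the base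
   point). *)
Definition tangent_vector := chart_index C -> V.

Definition velocity (gamma : R^o -> M) : tangent_vector :=
  fun i => if `[< chart_dom C i (gamma 0) >] then
             'D_1 (chart C i \o gamma) (0 : R^o) else 0.

(* T_u S for a subset S of M; T_u M itself is [tangent setT u]. *)
Definition tangent (S : set M) (u : M) : set tangent_vector :=
  [set w | exists (O : set R^o) (gamma : R^o -> M),
    [/\ open O, O 0, smooth_map O gamma, gamma @` O `<=` S
      & gamma 0 = u /\ w = velocity gamma]].

Definition tangent_map (V0 : normedModType R) (g : V0 -> M) (x v : V0) :
    tangent_vector :=
  velocity (fun t : R^o => g (x + (t : R) *: v)).

End Tangent.
Arguments smooth_map {R V M} C {V0}.
Arguments velocity {R V M} C.
Arguments tangent_map {R V M} C {V0}.

Definition linear_span (K : nzRingType) (V : lmodType K) (A : set V) : set V :=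
  [set w | exists (k : nat) (c : 'I_k -> K) (v : 'I_k -> V),
    (forall i, A (v i)) /\ w = \sum_(i < k) c i *: v i].

Record manifold (R : realType) (m : nat) := Manifold {
  carrier :> topologicalType;
  atlas :> charts 'rV[R]_m carrier;
  chart_inv : chart_index atlas -> 'rV[R]_m -> carrier;
  manifold_hausdorff : hausdorff_space carrier;
  manifold_countable : @second_countable carrier;
  chart_cover : forall a, exists i, chart_dom atlas i a;
  chart_dom_open : forall i, open (chart_dom atlas i);
  chartK : forall i a, chart_dom atlas i a ->
    chart_inv i (chart atlas i a) = a;
  chart_homeo : forall i (A : set carrier), A `<=` chart_dom atlas i ->
    (open A <-> open (chart atlas i @` A));
  chart_smooth : forall i j,
    smooth (chart atlas i @` (chart_dom atlas i `&` chart_dom atlas j))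
           (chart atlas j \o chart_inv i)
}.

Definition dotmul (R : realType) (m : nat) (u v : 'rV[R]_m) : R :=
  \sum_(k < m) u 0 k * v 0 k.

Section Manifold.
Variables (R : realType) (m : nat) (W : manifold R m).

(* [form_coef i] is the coefficient vector (chi_1, ..., chi_m) of the local
   expression sum_k chi_k dx^k on the image of the chart [i]. *)
Record one_form := OneForm {
  form_coef : chart_index W -> 'rV[R]_m -> 'rV[R]_m;
  form_smooth : forall i, smooth (chart W i @` chart_dom W i) (form_coef i);
  form_compat : forall i j a (w : tangent_vector W),
    chart_dom W i a -> chart_dom W j a -> tangent setT a w ->
    dotmul (form_coef i (chart W i a)) (w i) =
    dotmul (form_coef j (chart W j a)) (w j)
}.

(* chi and d chi in the chart [i], at the point of coordinates [y]. *)
Definition form_at (chi : one_form) i (y u : 'rV[R]_m) : R :=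
  dotmul (form_coef chi i y) u.

Definition dform_at (chi : one_form) i (y u v : 'rV[R]_m) : R :=
  dotmul ('D_u (form_coef chi i) y) v - dotmul ('D_v (form_coef chi i) y) u.

Definition form_vanishes (chi : one_form) (a : W)
    (L : set (tangent_vector W)) : Prop :=
  forall w, L w -> forall i, chart_dom W i a ->
    form_at chi i (chart W i a) (w i) = 0.

(* Embedded n-dimensional submanifolds: around each point, a local
   diffeomorphism F (with inverse G) of the coordinate space flattens N onto
   R^n x 0. *)
Definition submanifold (n : nat) (N : set W) : Prop :=
  forall a, N a -> exists (i : chart_index W) (O : set 'rV[R]_m)
      (F G : 'rV[R]_m -> 'rV[R]_m),
    [/\ chart_dom W i a /\ O (chart W i a),
        open O /\ O `<=` chart W i @` chart_dom W i,
        smooth O F /\ (forall y, O y -> G (F y) = y),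
        open (F @` O) /\ smooth (F @` O) G
      & forall b, chart_dom W i b -> O (chart W i b) ->
          (N b <-> forall k : 'I_m, (n <= k)%N -> F (chart W i b) 0 k = 0)].

End Manifold.

Section Contact.
Variables (R : realType) (n : nat) (W : manifold R (n.*2.+1)).
Implicit Type chi : one_form W.

(* Value of chi /\ (d chi)^n on a (2n+1)-tuple of vectors; 2^-n accounts for
   the antisymmetry of each of the n factors d chi. *)
Definition contact_top chi i (y : 'rV[R]_(n.*2.+1))
    (v : 'I_(n.*2.+1) -> 'rV[R]_(n.*2.+1)) : R :=
  2^-1 ^+ n * \sum_(s : 'S_(n.*2.+1)) (-1) ^+ s * form_at chi i y (v (s ord0)) *
    \prod_(k < n) dform_at chi i y (v (s (inord k.*2.+1)))
                                   (v (s (inord k.*2.+2))).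

Definition contact chi : Prop :=
  forall i a, chart_dom W i a ->
    exists v, contact_top chi i (chart W i a) v != 0.

End Contact.

Section Jets.
Variables (R : realType) (n : nat) (W : manifold R (n.*2.+1)).

(* The 1-jet of N at a is determined by a and T_a N. *)
Definition jet := (W * set (tangent_vector W))%type.

Definition jet_of (N : set W) (a : W) : jet := (a, tangent N a).

Definition J1 : set jet :=
  [set u | exists N a, [/\ submanifold n N, N a & u = jet_of N a]].

Definition prolongation (N : set W) : set jet := [set jet_of N a | a in N].

(* The standard coordinates (x^alpha, u^j, u^j_alpha) of J1 are attached to a
   chart i of W and a choice, encoded by the permutation s, of n of its
   coordinates as independent variables x^alpha, the n+1 other ones being the
   u^j: the plane is then the graph du^j = sum_alpha u^j_alpha dx^alpha. *)
Definition slopes (i : chart_index W) (s : 'S_(n.*2.+1)) (u : jet)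
    (A : 'M[R]_(n, n.+1)) : Prop :=
  forall w, tangent setT u.1 w ->
    (u.2 w <-> forall j : 'I_n.+1, w i 0 (s (inord (n + j))) =
                 \sum_(al < n) w i 0 (s (inord al)) * A al j).

Definition jet_charts : charts ('rV[R]_(n.*2.+1) * 'M[R]_(n, n.+1))%type jet :=
  {| chart_index := (chart_index W * 'S_(n.*2.+1))%type;
     chart_dom := fun k => [set u | [/\ J1 u, chart_dom W k.1 u.1
                                   & exists A, slopes k.1 k.2 u A]];
     chart := fun k u => (chart W k.1 u.1, xget 0 (slopes k.1 k.2 u)) |}.

(* The Cartan distribution E^1_n(W), at the jet u. *)
Definition cartan (u : jet) : set (tangent_vector jet_charts) :=
  linear_span [set w | exists N, [/\ submanifold n N, prolongation N u
                                  & tangent (prolongation N) u w]].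

Definition Leg (chi : one_form W) : set jet :=
  [set u | exists N a, [/\ submanifold n N, N a, u = jet_of N a
                        & form_vanishes chi a (tangent N a)]].

End Jets.

Definition std_simplex (R : realType) (p : nat) : set 'rV[R]_p.+1 :=
  [set x | (forall i, 0 <= x 0 i) /\ \sum_i x 0 i = 1].

Arguments std_simplex : clear implicits.

Definition face_map (R : realType) (p : nat) (i : 'I_p.+2)
    (x : 'rV[R]_p.+1) : 'rV[R]_p.+2 :=
  \row_j (if unlift i j is Some k then x 0 k else 0).

Section FaceMap.
Variables (R : realType) (p : nat) (i : 'I_p.+2).
Implicit Types x y : 'rV[R]_p.+1.

Lemma face_mapP k x y :
  face_map i (k *: x + y) = k *: face_map i x + face_map i y.
Proof.
apply/rowP => j; rewrite !mxE; case: unlift => [l|]; first by rewrite !mxE.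
by rewrite mulr0 addr0.
Qed.

Lemma sum_face_map x : \sum_j face_map i x 0 j = \sum_j x 0 j.
Proof.
rewrite (bigD1_ord i) //= mxE unlift_none add0r.
by apply: eq_bigr => j _; rewrite mxE liftK.
Qed.

Lemma face_map_simplex x : std_simplex R p x -> std_simplex R p.+1 (face_map i x).
Proof.
move=> [x0 x1]; split; last by rewrite sum_face_map.
by move=> j; rewrite mxE; case: unlift.
Qed.

Lemma face_map_continuous : continuous (@face_map R p i).
Proof.
move=> x A /nbhs_ballP[e e0 eA]; apply/nbhs_ballP; exists e => //= y [_ xy].
apply: eA; split => // a j.
by rewrite !mxE; case: unlift => [k|]; [exact: xy|exact: ballxx].
Qed.

Variable (V : normedModType R).

Lemma derive_face (f : 'rV[R]_p.+2 -> V) x v :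
  (fun h : R => h^-1 *: (((f \o face_map i) \o shift x) (h *: v)
      - (f \o face_map i) x)) =
  (fun h : R => h^-1 *: ((f \o shift (face_map i x)) (h *: face_map i v)
      - f (face_map i x))).
Proof. by apply/funext => h; rewrite /= face_mapP. Qed.

Lemma smooth_face (U : set 'rV[R]_p.+2) (f : 'rV[R]_p.+2 -> V) :
  smooth U f -> smooth (face_map i @^-1` U) (f \o face_map i).
Proof.
move=> sf k; move: (sf k) => {sf}; elim: k f => [|k IH] f [cf df].
  split=> // x Ux.
  by apply: continuous_comp; [exact: face_map_continuous|exact: cf].
split=> [x Ux|].
  by apply: continuous_comp; [exact: face_map_continuous|exact: cf].
case: df => df Df; split => [x v Ux|v].
  by rewrite /derivable derive_face; exact: df.
suff -> : 'D_v (f \o face_map i) = 'D_(face_map i v) f \o face_map i.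
  exact/IH/Df.
by apply/funext => x; rewrite /derive derive_face.
Qed.

End FaceMap.

Section BarSimplices.
Variables (R : realType) (n : nat) (W : manifold R (n.*2.+1)) (E : set (jet W)).

(* Tf(Delta^p) consists of the images of the vectors tangent to Delta^p, i.e.
   those with zero coordinate sum; at points of Delta^p they only depend on f,
   not on the extension g. *)
Definition is_bar_simplex (p : nat) (f : std_simplex R p -> jet W) : Prop :=
  exists (U : set 'rV[R]_p.+1) (g : 'rV[R]_p.+1 -> jet W),
    [/\ open U /\ std_simplex R p `<=` U,
        smooth_map (jet_charts W) U g,
        g @` U `<=` E,
        forall x : std_simplex R p, f x = g (set_val x)
      & forall x v : 'rV[R]_p.+1, std_simplex R p x -> \sum_i v 0 i = 0 ->
          (cartan (g x) `&` tangent E (g x))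
            (tangent_map (jet_charts W) g x v)].

Definition bar_simplex (p : nat) : choiceType :=
  set_type [set f | is_bar_simplex (p := p) f].

Definition face_simplex (p : nat) (i : 'I_p.+2) (x : std_simplex R p) :
    std_simplex R p.+1 :=
  SigSub (mem_set (face_map_simplex i (set_valP x))).

Lemma bar_face_subproof (p : nat) (i : 'I_p.+2) (f : bar_simplex p.+1) :
  (set_val f \o face_simplex i) \in [set f | is_bar_simplex (p := p) f].
Proof.
apply/mem_set; have [U [g [[Uo DU] sg gE fg Tg]]] := set_valP f.
exists (face_map i @^-1` U), (g \o face_map i); split.
- split; last by move=> x /(face_map_simplex i)/DU.
  by apply: open_comp => // x _; exact: face_map_continuous.
- move=> x k Ux kx; have [B [Bo Bx BU Bk sB]] := sg _ _ Ux kx.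
  exists (face_map i @^-1` B); split => //.
  + by apply: open_comp => // y _; exact: face_map_continuous.
  + by move=> y; exact: BU.
  + by move=> y; exact: Bk.
  + exact: (@smooth_face _ _ _ _ _ (chart (jet_charts W) k \o g)).
- by move=> _ [x Ux <-]; apply: gE; exists (face_map i x).
- by move=> x; exact: (fg (face_simplex i x)).
- move=> x v Dx v0.
  have := Tg _ (face_map i v) (face_map_simplex i Dx).
  rewrite sum_face_map => /(_ v0).
  rewrite /tangent_map; congr ((_ `&` _) (velocity _ _)).
  by apply/funext => t /=; rewrite addrC -face_mapP addrC.
Qed.

Definition bar_face (p : nat) (i : 'I_p.+2) (f : bar_simplex p.+1) :
  bar_simplex p := SigSub (bar_face_subproof i f).

End BarSimplices.
Arguments bar_face {R n W} E p i f.

(* [malg S G] is the group of finitely supported functions S -> G, i.e. of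
   formal finite linear combinations of elements of S. *)

Section ChainModule.
Variable (S : choiceType).

Definition chain (G : zmodType) : Type := malg S G.

HB.instance Definition _ (G : zmodType) := GRing.Zmodule.on (chain G).

Variables (K : nzRingType) (G : lmodType K).
Implicit Types (k : K) (c d : chain G).

Definition chain_scale k c : chain G :=
  \sum_(f <- msupp c) mkmalgU f (k *: mcoeff f c).

Lemma chain_scaleE k c f : mcoeff f (chain_scale k c) = k *: mcoeff f c.
Proof.
rewrite {2}[c]monalgE /chain_scale !raddf_sum /=.
by apply: eq_bigr => g _; rewrite !mcoeffU scalerMnr.
Qed.

Lemma chain_scaleA k l c :
  chain_scale k (chain_scale l c) = chain_scale (k * l) c.
Proof. by apply/malgP => f; rewrite !chain_scaleE scalerA. Qed.

Lemma chain_scale1 : left_id 1 chain_scale.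
Proof. by move=> c; apply/malgP => f; rewrite chain_scaleE scale1r. Qed.

Lemma chain_scaleDr : right_distributive chain_scale +%R.
Proof.
by move=> k c d; apply/malgP => f; rewrite !(mcoeffD, chain_scaleE) scalerDr.
Qed.

Lemma chain_scaleDl c : {morph chain_scale^~ c : k l / k + l}.
Proof.
by move=> k l; apply/malgP => f; rewrite !(mcoeffD, chain_scaleE) scalerDl.
Qed.

HB.instance Definition _ := GRing.Zmodule_isLmodule.Build K (chain G)
  chain_scaleA chain_scale1 chain_scaleDr chain_scaleDl.

Lemma mcoeff_scale k c f : mcoeff f (k *: c) = k *: mcoeff f c.
Proof. exact: chain_scaleE. Qed.

End ChainModule.

Section QuotientModule.
Variables (K : nzRingType) (V : lmodType K) (I : zmodClosed V).
Hypothesis scaleI : forall k : K, {in I, forall v, k *: v \in I}.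
Local Open Scope quotient_scope.
Local Notation Q := (Quotient.quot I).

Definition quot_scale (k : K) (x : Q) : Q := \pi_Q (k *: repr x).

Lemma quot_scale_pi k v : quot_scale k (\pi_Q v) = \pi_Q (k *: v).
Proof.
apply/eqP; rewrite /quot_scale -(Quotient.idealrBE I) -scalerBr; apply: scaleI.
by rewrite (Quotient.idealrBE I) reprK.
Qed.

Lemma quot_scaleA k l x : quot_scale k (quot_scale l x) = quot_scale (k * l) x.
Proof. by rewrite [quot_scale l x]/quot_scale quot_scale_pi scalerA. Qed.

Lemma quot_scale1 : left_id 1 quot_scale.
Proof. by move=> x; rewrite /quot_scale scale1r reprK. Qed.

Lemma quot_scaleDr : right_distributive quot_scale +%R.
Proof.
move=> k; elim/quotW => v; elim/quotW => w.
by rewrite -raddfD !quot_scale_pi scalerDr raddfD.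
Qed.

Lemma quot_scaleDl x : {morph quot_scale^~ x : k l / k + l}.
Proof. by move=> k l; rewrite /quot_scale scalerDl raddfD. Qed.

Definition quot_lmodule : GRing.Zmodule_isLmodule K Q :=
  GRing.Zmodule_isLmodule.Build K Q
    quot_scaleA quot_scale1 quot_scaleDr quot_scaleDl.

End QuotientModule.

Section ChainComplex.
Variables (S : nat -> choiceType) (face : forall p, 'I_p.+2 -> S p.+1 -> S p).

Section Boundary.
Variables (G : zmodType) (p : nat).

Definition bdry (c : chain (S p.+1) G) : chain (S p) G :=
  \sum_(f <- msupp c) \sum_(i < p.+2)
    mkmalgU (face i f) (mcoeff f c *~ (-1) ^+ i).

Lemma bdryE (D : {fset S p.+1}) (c : chain (S p.+1) G) :
  fsubset (msupp c) D ->
  bdry c = \sum_(f <- D) \sum_(i < p.+2)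
             mkmalgU (face i f) (mcoeff f c *~ (-1) ^+ i).
Proof.
move=> cD; rewrite /bdry (big_fset_incl _ cD) //= => f _ /mcoeff_outdom ->.
by rewrite big1 // => i _; rewrite mul0rz raddf0.
Qed.

Lemma bdry_is_zmod_morphism : zmod_morphism bdry.
Proof.
move=> c d.
pose D := fsetU (msupp (c - d)) (fsetU (msupp c) (msupp d)).
rewrite !(@bdryE D) ?fsubsetUl //; last 2 first.
- exact: fsubset_trans (fsubsetUr _ _) (fsubsetUr _ _).
- exact: fsubset_trans (fsubsetUl _ _) (fsubsetUr _ _).
rewrite -sumrB; apply: eq_bigr => f _; rewrite -sumrB; apply: eq_bigr => i _.
by rewrite mcoeffB mulrzBl raddfB.
Qed.

HB.instance Definition _ :=
  GRing.isZmodMorphism.Build (chain (S p.+1) G) (chain (S p) G) bdry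
    bdry_is_zmod_morphism.

End Boundary.

Lemma bdry_scalable (K : nzRingType) (G : lmodType K) (p : nat) :
  scalable (@bdry G p).
Proof.
move=> k c; have cD : fsubset (msupp (k *: c)) (msupp c).
  apply/fsubsetP => f; rewrite -!mcoeff_neq0 mcoeff_scale.
  by apply: contra_neq => ->; rewrite scaler0.
rewrite (bdryE cD) /bdry scaler_sumr; apply: eq_bigr => f _.
rewrite scaler_sumr; apply: eq_bigr => i _; apply/malgP => g.
by rewrite [RHS]mcoeff_scale !mcoeffU mcoeff_scale -scalerMnr scalerMzr.
Qed.

Definition is_cycle (G : zmodType) (p : nat) : chain (S p) G -> bool :=
  match p with
  | 0 => fun=> true
  | p'.+1 => fun c => bdry c == 0
  end.

Definition is_boundary (G : zmodType) (p : nat) : chain (S p) G -> bool :=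
  fun c => `[< exists d : chain (S p.+1) G, bdry d = c >].

Lemma cycle_zmod_closed G p : zmod_closed (@is_cycle G p).
Proof.
case: p => [|p]; first by [].
split=> [|c d]; rewrite !unfold_in /= ?raddf0 //.
by move=> /eqP c0 /eqP d0; rewrite raddfB /= c0 d0 subr0.
Qed.

Lemma boundary_zmod_closed G p : zmod_closed (@is_boundary G p).
Proof.
split=> [|_ _ /asboolP[c <-] /asboolP[d <-]]; apply/asboolP.
  by exists 0; rewrite raddf0.
by exists (c - d); rewrite raddfB.
Qed.

HB.instance Definition _ G p :=
  GRing.isZmodClosed.Build _ (@is_cycle G p) (@cycle_zmod_closed G p).
HB.instance Definition _ G p :=
  GRing.isZmodClosed.Build _ (@is_boundary G p) (@boundary_zmod_closed G p).

Lemma cycle_scaler (K : nzRingType) (G : lmodType K) p (k : K) :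
  {in @is_cycle G p, forall c, k *: c \in @is_cycle G p}.
Proof.
by case: p => // p c; rewrite !unfold_in /= bdry_scalable => /eqP ->; rewrite scaler0.
Qed.

Lemma boundary_scaler (K : nzRingType) (G : lmodType K) p (k : K) :
  {in @is_boundary G p, forall c, k *: c \in @is_boundary G p}.
Proof.
by move=> _ /asboolP[c <-]; apply/asboolP; exists (k *: c); rewrite bdry_scalable.
Qed.

Record cycles (G : zmodType) (p : nat) := Cycles {
  cycle_val : chain (S p) G;
  cycle_valP : cycle_val \in @is_cycle G p
}.

HB.instance Definition _ G p := [isSub for @cycle_val G p].
HB.instance Definition _ G p := [Choice of cycles G p by <:].
HB.instance Definition _ G p := [SubChoice_isSubZmodule of cycles G p by <:].

Section CyclesModule.
Variables (K : nzRingType) (G : lmodType K) (p : nat).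

Definition cycles_scale (k : K) (a : cycles G p) : cycles G p :=
  Cycles (cycle_scaler k (cycle_valP a)).

Lemma cycles_scaleA k l a :
  cycles_scale k (cycles_scale l a) = cycles_scale (k * l) a.
Proof. by apply/val_inj; rewrite /= scalerA. Qed.

Lemma cycles_scale1 : left_id 1 cycles_scale.
Proof. by move=> a; apply/val_inj; rewrite /= scale1r. Qed.

Lemma cycles_scaleDr : right_distributive cycles_scale +%R.
Proof. by move=> k a b; apply/val_inj; rewrite /= scalerDr. Qed.

Lemma cycles_scaleDl a : {morph cycles_scale^~ a : k l / k + l}.
Proof. by move=> k l; apply/val_inj; rewrite /= scalerDl. Qed.

HB.instance Definition _ := GRing.Zmodule_isLmodule.Build K (cycles G p)
  cycles_scaleA cycles_scale1 cycles_scaleDr cycles_scaleDl.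

End CyclesModule.

Definition bordant (G : zmodType) (p : nat) (a b : cycles G p) : Prop :=
  exists c : chain (S p.+1) G, cycle_val a - cycle_val b = bdry c.

Definition null_bordant (G : zmodType) (p : nat) : cycles G p -> bool :=
  fun a => `[< bordant a 0 >].

Definition bounding_cycle (G : zmodType) (p : nat) : cycles G p -> bool :=
  fun a => cycle_val a \in @is_boundary G p.

Lemma null_bordant_zmod_closed G p : zmod_closed (@null_bordant G p).
Proof.
split=> [|a b /asboolP[c ac] /asboolP[d bd]]; apply/asboolP.
  by exists 0; rewrite subrr raddf0.
exists (c - d); rewrite raddfB /= -ac -bd /= !subr0.
by [].
Qed.

Lemma bounding_cycle_zmod_closed G p : zmod_closed (@bounding_cycle G p).
Proof.
have [B0 BB] := @boundary_zmod_closed G p.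
by split=> [|a b aB bB]; [exact: B0|exact: BB].
Qed.

HB.instance Definition _ G p :=
  GRing.isZmodClosed.Build _ (@null_bordant G p) (@null_bordant_zmod_closed G p).
HB.instance Definition _ G p :=
  GRing.isZmodClosed.Build _ (@bounding_cycle G p)
    (@bounding_cycle_zmod_closed G p).

Lemma null_bordant_scaler (K : nzRingType) (G : lmodType K) p (k : K) :
  {in @null_bordant G p, forall a, k *: a \in @null_bordant G p}.
Proof.
move=> a /asboolP[c ac]; apply/asboolP; exists (k *: c).
by rewrite bdry_scalable -ac /= !subr0.
Qed.

Lemma bounding_cycle_scaler (K : nzRingType) (G : lmodType K) p (k : K) :
  {in @bounding_cycle G p, forall a, k *: a \in @bounding_cycle G p}.
Proof. by move=> a aB; exact: (@boundary_scaler K G p k _ aB). Qed.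

Section Groups.
Variables (G : zmodType) (p : nat).

Definition barH : Type :=
  Quotient.quot (GRing.ZmodClosed.clone (cycles G p) (@bounding_cycle G p) _).
Definition barBor : Type :=
  Quotient.quot (GRing.ZmodClosed.clone (chain (S p) G) (@is_boundary G p) _).
Definition barCyc : Type :=
  Quotient.quot (GRing.ZmodClosed.clone (chain (S p) G) (@is_cycle G p) _).
(* Closed chains modulo [bordant], see [barOmegaP]. *)
Definition barOmega : Type :=
  Quotient.quot (GRing.ZmodClosed.clone (cycles G p) (@null_bordant G p) _).

HB.instance Definition _ := GRing.Zmodule.on barH.
HB.instance Definition _ := GRing.Zmodule.on barBor.
HB.instance Definition _ := GRing.Zmodule.on barCyc.
HB.instance Definition _ := GRing.Zmodule.on barOmega.

Lemma barOmegaP (a b : cycles G p) :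
  \pi_(Quotient.quot (GRing.ZmodClosed.clone (cycles G p) (@null_bordant G p) _))%qT a =
  \pi_(Quotient.quot (GRing.ZmodClosed.clone (cycles G p) (@null_bordant G p) _))%qT b <-> bordant a b.
Proof.
split=> [/eqP|ab]; last apply/eqP; rewrite -Quotient.idealrBE.
  by move=> /asboolP[c]; rewrite /= subr0; exists c.
by apply/asboolP; move: ab => [c ac]; exists c; rewrite /= subr0.
Qed.

End Groups.

Section Modules.
Variables (K : nzRingType) (G : lmodType K) (p : nat).

HB.instance Definition _ : GRing.Zmodule_isLmodule K (barH G p) :=
  quot_lmodule (@bounding_cycle_scaler K G p).
HB.instance Definition _ : GRing.Zmodule_isLmodule K (barBor G p) :=
  quot_lmodule (@boundary_scaler K G p).
HB.instance Definition _ : GRing.Zmodule_isLmodule K (barCyc G p) :=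
  quot_lmodule (@cycle_scaler K G p).
HB.instance Definition _ : GRing.Zmodule_isLmodule K (barOmega G p) :=
  quot_lmodule (@null_bordant_scaler K G p).

End Modules.

End ChainComplex.

Definition additive_iso (A B : zmodType) : Prop :=
  exists f : {additive A -> B}, bijective f.

Definition linear_iso (K : nzRingType) (A B : lmodType K) : Prop :=
  exists f : {linear A -> B}, bijective f.

Definition free_module (K : nzRingType) (M : lmodType K) : Prop :=
  exists I : choiceType, linear_iso (malg I K) M.

(* An abelian group G has no canonical ring of scalars: "free G-module" is
   read relatively to an arbitrary ring K acting on G (K = int for any G, or
   K = G acting by multiplication when G is itself a ring). *)
Record scalar_action (K : nzRingType) (G : zmodType) := ScalarAction {
  sact : K -> G -> G;
  sactA : forall k l g, sact k (sact l g) = sact (k * l) g;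
  sact1 : left_id 1 sact;
  sactDr : right_distributive sact +%R;
  sactDl : forall g, {morph sact^~ g : k l / k + l}
}.

Definition acted (K : nzRingType) (G : zmodType) (a : scalar_action K G) : Type :=
  G.

Section Acted.
Variables (K : nzRingType) (G : zmodType) (a : scalar_action K G).
HB.instance Definition _ := GRing.Zmodule.on (acted a).
HB.instance Definition _ := GRing.Zmodule_isLmodule.Build K (acted a)
  (sactA a) (sact1 a) (sactDr a) (sactDl a).
End Acted.

(* Main.v *)
Require Import Defs.
From HB Require Import structures.
From mathcomp Require Import all_boot all_order all_fingroup all_algebra.
From mathcomp Require Import finmap all_classical all_reals all_analysis.
From mathcomp Require Import generic_quotient ring_quotient.
From mathcomp Require multinomials.monalg.
Import -(notations) monalg.
From mathcomp Require Import zify.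
Import GRing.Theory.

Set Implicit Arguments.
Unset Strict Implicit.
Unset Printing Implicit Defensive.

(** The four groups are all quotients of the module of bar chains or of its
    submodule of cycles, so the theorem is homological algebra once the bar
    chains are known to form a complex.  That boundaries are cycles
    ([boundary_is_cycle]) follows from the simplicial identity between faces,
    which bar simplices inherit from the affine face maps of the standard
    simplices ([bar_face_simplicial]).

    Two surjections from one module with the same kernel have isomorphic
    targets ([same_kernel_iso]).  Bordism to zero is the property of being a
    boundary, so this identifies the closed bordism group with homology; and
    when that group vanishes every cycle is a boundary, so it identifies
    chains modulo boundaries with chains modulo cycles.  In general
    0 -> Omega -> Bor -> Cyc -> 0 is exact, and a free quotient splits the
    sequence ([split_exact]), because the images of its basis can be lifted
    and the lifts extended linearly ([free_section]). *)

(** * Maps out of a quotient *)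

Section Factorization.
Local Open Scope ring_scope.

(** A surjection serves as a quotient map, so that the groups of the theorem
    can be handled through their projections alone; [h] is [g] applied to
    chosen preimages, and the inclusion of kernels makes the choice
    immaterial. *)
Lemma additive_factor (V A B : zmodType)
    (f : {additive V -> A}) (g : {additive V -> B}) :
  (forall a, exists v, f v = a) -> (forall v, f v = 0 -> g v = 0) ->
  exists h : {additive A -> B}, forall v, h (f v) = g v.
Proof.
move=> fsurj fg0.
pose r a := projT1 (cid (fsurj a)).
have rK a : f (r a) = a by rewrite /r; case: cid.
have grE v : g (r (f v)) = g v.
  by apply/eqP; rewrite -subr_eq0 -raddfB fg0 // raddfB rK subrr.
have h_add : zmod_morphism (g \o r).
  by move=> a b; rewrite -[in LHS](rK a) -[in LHS](rK b) -raddfB /= grE raddfB.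
pose H := GRing.isZmodMorphism.Build A B (g \o r) h_add.
by exists (HB.pack (g \o r) H : {additive A -> B}).
Qed.

Lemma linear_factor (K : nzRingType) (V A B : lmodType K)
    (f : {linear V -> A}) (g : {linear V -> B}) :
  (forall a, exists v, f v = a) -> (forall v, f v = 0 -> g v = 0) ->
  exists h : {linear A -> B}, forall v, h (f v) = g v.
Proof.
move=> fsurj fg0; have [h hf] := additive_factor fsurj fg0.
have h_scal : scalable h.
  move=> k a; have [v <-] := fsurj a.
  by rewrite -(linearZ_LR f) !hf; exact: linearZ_LR.
pose H := GRing.isScalable.Build K A B *:%R h h_scal.
by exists (HB.pack (GRing.Additive.sort h) H : {linear A -> B}).
Qed.

Lemma same_kernel_iso (V A B : zmodType)
    (f : {additive V -> A}) (g : {additive V -> B}) :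
  (forall a, exists v, f v = a) -> (forall b, exists v, g v = b) ->
  (forall v, f v = 0 <-> g v = 0) -> additive_iso A B.
Proof.
move=> fsurj gsurj fg.
have [h hf] := additive_factor fsurj (fun v => (fg v).1).
have [k kg] := additive_factor gsurj (fun v => (fg v).2).
exists h; exists k => [a|b].
  by have [v <-] := fsurj a; rewrite hf kg.
by have [v <-] := gsurj b; rewrite kg hf.
Qed.

Lemma linear_inverse (K : nzRingType) (A B : lmodType K)
    (f : {linear A -> B}) :
  bijective f -> exists g : {linear B -> A}, cancel f g /\ cancel g f.
Proof.
move=> bf; have [f' _ f'K] := bf.
have [||g gf] := @linear_factor K A B A f idfun.
- by move=> b; exists (f' b).
- by move=> a fa0; apply: (bij_inj bf); rewrite fa0 raddf0.
by exists g; split=> [//|b]; rewrite -[b]f'K gf.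
Qed.

End Factorization.

(** * Split exact sequences *)

Section Splitting.
Local Open Scope ring_scope.
Variable K : nzRingType.

Lemma malg_lift (I : choiceType) (B : lmodType K) (b : I -> B) :
  exists h : {linear malg I K -> B}, forall i, h (mkmalgU i 1) = b i.
Proof.
pose h (x : malg I K) : B := \sum_(i <- msupp x) mcoeff i x *: b i.
have hE (D : {fset I}%fset) (x : malg I K) : (msupp x `<=` D)%fset ->
    h x = \sum_(i <- D) mcoeff i x *: b i.
  move=> xD; rewrite /h (big_fset_incl _ xD) //= => i _ /mcoeff_outdom ->.
  by rewrite scale0r.
have h_lin : linear h.
  move=> k x y.
  pose D := (msupp (k *: x + y) `|` (msupp x `|` msupp y))%fset.
  rewrite !(hE D) ?fsubsetUl //; last 2 first.
  - exact: fsubset_trans (fsubsetUr _ _) (fsubsetUr _ _).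
  - exact: fsubset_trans (fsubsetUl _ _) (fsubsetUr _ _).
  rewrite scaler_sumr -big_split /=; apply: eq_bigr => i _.
  by rewrite mcoeffD mcoeffZ scalerDl scalerA.
pose H := GRing.isLinear.Build K (malg I K) B *:%R h h_lin.
exists (HB.pack h H : {linear malg I K -> B}) => i /=.
by rewrite (hE _ _ msuppU_le) big_seq_fset1 mcoeffUU scale1r.
Qed.

Lemma malg_linear_eq (I : choiceType) (B : lmodType K)
    (f g : {linear malg I K -> B}) :
  (forall i, f (mkmalgU i 1) = g (mkmalgU i 1)) -> f =1 g.
Proof.
move=> fg x; rewrite [x]monalgE !raddf_sum; apply: eq_bigr => i _ /=.
have -> : mkmalgU i (mcoeff i x) = mcoeff i x *: mkmalgU i (1 : K).
  by apply/malgP => j; rewrite mcoeffZ !mcoeffU mulrnAr mulr1.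
by rewrite !linearZ fg.
Qed.

Lemma free_section (B C : lmodType K) (q : {linear B -> C}) :
  (forall c, exists b, q b = c) -> free_module C ->
  exists s : {linear C -> B}, cancel s q.
Proof.
move=> qsurj [I [e be]].
have [e' [_ e'K]] := linear_inverse be.
pose b i := projT1 (cid (qsurj (e (mkmalgU i 1)))).
have qb i : q (b i) = e (mkmalgU i 1) by rewrite /b; case: cid.
have [h hb] := malg_lift b.
have qh : q \o h =1 e by apply: malg_linear_eq => i /=; rewrite hb qb.
by exists (h \o e') => c /=; rewrite [LHS]qh e'K.
Qed.

(** With [s] a section of [q], the map (x, y) |-> j x + s y is bijective: any
    [b] differs from [s (q b)] by an element of the kernel of [q], which is the
    image of [j]. *)
Lemma split_exact (O B C : lmodType K)
    (j : {linear O -> B}) (q : {linear B -> C}) :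
  injective j -> (forall c, exists b, q b = c) ->
  (forall b, q b = 0 <-> exists o, j o = b) ->
  free_module C -> linear_iso B (O * C)%type.
Proof.
move=> jinj qsurj ex free; have [s sK] := free_section qsurj free.
pose f (x : O * C) := j x.1 + s x.2.
have f_lin : linear f by move=> k x y; rewrite /f /= !linearP scalerDr addrACA.
pose H := GRing.isLinear.Build K (O * C)%type B *:%R f f_lin.
pose F : {linear (O * C)%type -> B} := HB.pack f H.
have ker b : exists o, j o = b - s (q b).
  by apply/ex; rewrite raddfB /= sK subrr.
pose r b := projT1 (cid (ker b)).
have rP b : j (r b) = b - s (q b) by rewrite /r; case: cid.
have qj o : q (j o) = 0 by apply/ex; exists o.
have bF : bijective F.
  exists (fun b => (r b, q b)) => [[u c]|b]; rewrite /= /f /=.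
    have qE : q (j u + s c) = c by rewrite raddfD /= qj sK add0r.
    by congr pair => //; apply: jinj; rewrite rP qE addrK.
  by rewrite rP subrK.
have [g [FK gK]] := linear_inverse bF.
by exists g; exists F.
Qed.

End Splitting.

(** * Canonical projections *)

Section QuotientProjection.
Local Open Scope ring_scope.
Local Open Scope quotient_scope.

Lemma quot_additive_proj (V : zmodType) (I : zmodClosed V) :
  exists f : {additive V -> Quotient.quot I},
    (forall a, exists v, f v = a) /\ (forall v, f v = 0 <-> v \in I).
Proof.
exists (\pi_(Quotient.quot I)); split.
  by elim/quotW => v; exists v.
move=> v; rewrite -[v in v \in I]subr0 (Quotient.idealrBE I) raddf0.
exact: (rwP eqP).
Qed.

(** The module [Q] is built from [quot_lmodule] exactly as the module
    structures of the bordism and homology groups are, hence convertible to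
    each of them for the appropriate [I]. *)
Lemma quot_linear_proj (K : nzRingType) (V : lmodType K) (I : zmodClosed V)
    (scaleI : forall k : K, {in I, forall v, k *: v \in I})
    (Q : lmodType K := HB.pack (Quotient.quot I) (quot_lmodule scaleI)) :
  exists f : {linear V -> Q},
    (forall a, exists v, f v = a) /\ (forall v, f v = 0 <-> v \in I).
Proof.
pose f : V -> Q := \pi_(Quotient.quot I).
have f_lin : linear f.
  move=> k v w; rewrite /f raddfD; congr (_ + _).
  exact: esym (quot_scale_pi scaleI k v).
pose H := GRing.isLinear.Build K V Q *:%R f f_lin.
exists (HB.pack f H : {linear V -> Q}); split.
  by elim/quotW => v; exists v.
move=> v; rewrite -[v in v \in I]subr0 (Quotient.idealrBE I) raddf0.
exact: (rwP eqP).
Qed.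

End QuotientProjection.

(** * Boundaries are cycles *)

Section SimplicialIdentities.
Local Open Scope ring_scope.
Variables (S : nat -> choiceType) (face : forall p, 'I_p.+2 -> S p.+1 -> S p).

(** The identity d_j d_(i+1) = d_i d_j for j <= i.  Writing the outer index as
    [lift ord0 i] instead of assuming j < i' avoids a predecessor on
    ordinals. *)
Definition simplicial :=
  forall p (i j : 'I_p.+2) (f : S p.+2), (j <= i)%N ->
    face j (face (lift ord0 i) f) =
    face i (face (widen_ord (leqnSn _) j) f).

Hypothesis faceP : simplicial.

Lemma bdryU (G : zmodType) p (f : S p.+1) (g : G) :
  bdry face (mkmalgU f g) =
  \sum_(i < p.+2) mkmalgU (face i f) (g *~ (-1) ^+ i).
Proof. by rewrite (bdryE face msuppU_le) big_seq_fset1 mcoeffUU. Qed.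

(** On a generator, the double sum over pairs (i, j) of deleted vertices is cut
    along j < i; the simplicial identity matches the pair (j+1, i) of one part
    with the pair (i, j), i <= j, of the other, and the signs are opposite. *)
Lemma bdry_bdry (G : zmodType) p (c : chain (S p.+2) G) :
  bdry face (bdry face c) = 0.
Proof.
suff generator (f : S p.+2) (g : G) : bdry face (bdry face (mkmalgU f g)) = 0.
  rewrite [c]monalgE.
  apply: (big_ind (fun x => bdry face (bdry face x) = 0)) => [|x y x0 y0|f _].
  - by rewrite raddf0 raddf0.
  - by rewrite raddfD raddfD /= x0 y0 addr0.
  - exact: generator.
rewrite bdryU (raddf_sum (@bdry _ face G p)) /=.
under eq_bigr do rewrite bdryU.
rewrite pair_bigA (bigID (fun x : 'I_p.+3 * 'I_p.+2 => x.2 < x.1)%N) /=.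
(* [h] maps the part j < i onto the part i <= j, and [h'] is its inverse;
   [inord] only plays the role of a cast, its argument being in range on the
   parts where it matters. *)
pose h (x : 'I_p.+3 * 'I_p.+2) : 'I_p.+3 * 'I_p.+2 :=
  (widen_ord (leqnSn _) x.2, inord x.1.-1).
pose h' (x : 'I_p.+3 * 'I_p.+2) : 'I_p.+3 * 'I_p.+2 :=
  (lift ord0 x.2, inord x.1).
rewrite [X in X + _](reindex_onto h' h) /=; last first.
  move=> [i j] /= ij; have iP := ltn_ord i.
  rewrite /h /h' /=; congr pair; apply/val_inj => /=.
    by rewrite /bump /= inordK; lia.
  by rewrite inordK.
apply/eqP; rewrite addr_eq0 -sumrN; apply/eqP; apply: eq_big.
  move=> [i j] /=; have [iP jP] := (ltn_ord i, ltn_ord j).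
  rewrite /h /h' /= xpair_eqE -!val_eqE /= /bump /=.
  have [ij|ij] := leqP i j.
    by rewrite !inordK //; lia.
  (* Outside the part i <= j, both conditions on (i, j) are false; for
     i = p.+2, [inord i] is the default value and not [i]. *)
  have [ip|ip] := ltnP i p.+2; first by rewrite inordK; lia.
  apply/negP => /andP[_ /andP[/eqP e _]]; move: e.
  by have := ltn_ord (inord i : 'I_p.+2); lia.
move=> [i j] /=; rewrite /h /h' /= xpair_eqE -!val_eqE /= => /andP[lt e].
have ij : (inord i : 'I_p.+2) = i :> nat by case/andP: e => /eqP.
rewrite faceP; last by move: lt; rewrite /bump /=; lia.
rewrite -raddfN /=; congr mkmalgU.
  by congr (face _ (face _ _)); apply/val_inj.
by rewrite -!mulrzA ij /bump /= exprS mulN1r mulNr mulrNz mulrC.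
Qed.

Lemma boundary_is_cycle (G : zmodType) p (c : chain (S p) G) :
  c \in @is_boundary _ face G p -> c \in @is_cycle _ face G p.
Proof.
move=> /asboolP[d <-]; case: p c d => [//|p] _ d.
by rewrite unfold_in /= bdry_bdry.
Qed.

End SimplicialIdentities.

(** * Bordism groups of a simplicial family *)

Section Bordism.
Local Open Scope ring_scope.
Variables (S : nat -> choiceType) (face : forall p, 'I_p.+2 -> S p.+1 -> S p).

Lemma null_bordant_boundary (G : zmodType) p (z : cycles face G p) :
  (z \in @null_bordant _ face G p) = (z \in @bounding_cycle _ face G p).
Proof.
by rewrite !unfold_in; apply/asboolP/asboolP => -[d dz]; exists d;
  move: dz; rewrite /= subr0.
Qed.

Lemma barOmega_barH (G : zmodType) p :
  additive_iso (barOmega face G p) (barH face G p).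
Proof.
have [f [fsurj f0]] := quot_additive_proj
  (GRing.ZmodClosed.clone (cycles face G p) (@null_bordant _ face G p) _).
have [g [gsurj g0]] := quot_additive_proj
  (GRing.ZmodClosed.clone (cycles face G p) (@bounding_cycle _ face G p) _).
apply: (same_kernel_iso fsurj gsurj) => z.
by rewrite f0 g0; have := null_bordant_boundary z; rewrite /= => ->.
Qed.

Hypothesis faceP : simplicial face.

Lemma barBor_barCyc (G : zmodType) p :
  (forall x : barOmega face G p, x = 0) ->
  additive_iso (barBor face G p) (barCyc face G p).
Proof.
move=> Omega0.
have [f [fsurj f0]] := quot_additive_proj
  (GRing.ZmodClosed.clone (chain (S p) G) (@is_boundary _ face G p) _).
have [g [gsurj g0]] := quot_additive_proj
  (GRing.ZmodClosed.clone (chain (S p) G) (@is_cycle _ face G p) _).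
have [h [_ h0]] := quot_additive_proj
  (GRing.ZmodClosed.clone (cycles face G p) (@null_bordant _ face G p) _).
apply: (same_kernel_iso fsurj gsurj) => c; rewrite f0 g0; split.
  exact: boundary_is_cycle.
move=> cZ; have /h0 := Omega0 (h (Cycles cZ)).
by have := null_bordant_boundary (Cycles cZ); rewrite /= => ->.
Qed.

(** The exact sequence 0 -> barOmega -> barBor -> barCyc -> 0 is induced by the
    inclusion of cycles into chains and by the identity of chains. *)
Lemma barBor_split (K : nzRingType) (G : lmodType K) p :
  free_module (barCyc face G p) ->
  linear_iso (barBor face G p) (barOmega face G p * barCyc face G p)%type.
Proof.
have [f [fsurj f0]] : exists f : {linear chain (S p) G -> barBor face G p},
    (forall a, exists v, f v = a) /\
    (forall v, f v = 0 <-> v \in @is_boundary _ face G p).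
  exact: (quot_linear_proj (@boundary_scaler _ face K G p)).
have [g [gsurj g0]] : exists g : {linear chain (S p) G -> barCyc face G p},
    (forall a, exists v, g v = a) /\
    (forall v, g v = 0 <-> v \in @is_cycle _ face G p).
  exact: (quot_linear_proj (@cycle_scaler _ face K G p)).
have [h [hsurj h0]] : exists h : {linear cycles face G p -> barOmega face G p},
    (forall a, exists v, h v = a) /\
    (forall v, h v = 0 <-> v \in @null_bordant _ face G p).
  exact: (quot_linear_proj (@null_bordant_scaler _ face K G p)).
have hf z : h z = 0 <-> f (cycle_val z) = 0.
  by rewrite h0 f0 null_bordant_boundary.
have [q qf] := linear_factor fsurj
  (fun v fv0 => (g0 v).2 (boundary_is_cycle faceP ((f0 v).1 fv0))).
have val_lin : linear (@cycle_val _ face G p) by [].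
pose H := GRing.isLinear.Build K _ _ *:%R (@cycle_val _ face G p) val_lin.
pose incl : {linear cycles face G p -> chain (S p) G} :=
  HB.pack (@cycle_val _ face G p) H.
have [j jh] := @linear_factor K _ _ _ h (f \o incl) hsurj (fun z => (hf z).1).
apply: (@split_exact _ _ _ _ j q).
- apply: raddf_inj => o; have [z <-] := hsurj o.
  by rewrite /= jh => /hf.
- by move=> c; have [v <-] := gsurj c; exists (f v).
- move=> b; split=> [|[u <-]].
    have [v <-] := fsurj b; rewrite qf => /g0 vZ.
    by exists (h (Cycles vZ)); rewrite jh.
  by have [z <-] := hsurj u; rewrite jh qf; apply/g0/cycle_valP.
Qed.

End Bordism.

(** * Faces of bar simplices *)

Section BarFaces.
Local Open Scope ring_scope.
Variables (R : realType).

(** Both composites insert zeros at the coordinates [j] and [i.+1], and shift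
    the coordinates of [x] to the other places in order. *)
Lemma face_map_comp p (i j : 'I_p.+2) (x : 'rV[R]_p.+1) : (j <= i)%N ->
  face_map (lift ord0 i) (face_map j x) =
  face_map (widen_ord (leqnSn _) j) (face_map i x).
Proof.
move=> ji; apply/rowP => k.
have bumps (l : 'I_p.+1) :
    lift (lift ord0 i) (lift j l) = lift (widen_ord (leqnSn _) j) (lift i l).
  by apply/val_inj; rewrite /= /bump; lia.
have outer : lift (lift ord0 i) j = widen_ord (leqnSn _) j.
  by apply/val_inj; rewrite /= /bump; lia.
have inner : lift (widen_ord (leqnSn _) j) i = lift ord0 i.
  by apply/val_inj; rewrite /= /bump; lia.
rewrite [LHS]mxE; case: unliftP => [m ->|->]; last first.
  by rewrite -inner mxE liftK mxE unlift_none.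
rewrite mxE; case: unliftP => [l ->|->].
  by rewrite bumps mxE liftK mxE liftK.
by rewrite outer mxE unlift_none.
Qed.

Lemma bar_face_simplicial n (W : manifold R n.*2.+1) (E : set (jet W)) :
  simplicial (bar_face E).
Proof.
move=> p i j f ji; apply/val_inj/funext => x /=.
congr (set_val f _); apply/val_inj => /=; exact: face_map_comp.
Qed.

End BarFaces.

Theorem theoremB2 (R : realType) (n : nat) (W : manifold R (n.*2.+1))
    (chi : one_form W) (chi_contact : contact chi) (G : zmodType) (p : nat) :
  [/\ additive_iso (barOmega (bar_face (Leg chi)) G p)
                   (barH (bar_face (Leg chi)) G p),
      (forall x : barOmega (bar_face (Leg chi)) G p, x = 0%R) ->
        additive_iso (barBor (bar_face (Leg chi)) G p)
                     (barCyc (bar_face (Leg chi)) G p)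
    & forall (K : nzRingType) (a : scalar_action K G),
        free_module (barCyc (bar_face (Leg chi)) (acted a) p) ->
        linear_iso (barBor (bar_face (Leg chi)) (acted a) p)
                   (barOmega (bar_face (Leg chi)) (acted a) p *
                    barCyc (bar_face (Leg chi)) (acted a) p)%type].
Proof.
split.
- exact: barOmega_barH.
- exact: (barBor_barCyc (@bar_face_simplicial _ _ _ _)).
- move=> K a; exact: (barBor_split (@bar_face_simplicial _ _ _ _)).
Qed.
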